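(* Let $\mathcal{R}$ be a discrete representable signature. If $s, s'$ are $\to_{\mathsf{rep}}$-normal terms with $s, s' \in \mathrm{Rep}(\mathcal{R})(\gamma;a)$ (same context $\gamma$ and type $a$), then $s \equiv s'$.
   Context: A representable signature consists of a set $\mathcal{A}$ of atoms and a multigraph $\mathcal{R}$ whose nodes (types) are generated by $a ::= o \in \mathcal{A} \mid (a_1 \otimes \cdots \otimes a_k)$ for $k \in \mathbb{N}$, with sets $\mathcal{R}(a_1,\dots,a_n;b)$ of multiarrows; it is discrete when it has no multiarrows. Representable terms (for discrete signatures): $s,t ::= x \mid \langle s_1,\dots,s_k\rangle \mid s[x_1^{a_1},\dots,x_k^{a_k} := t]$; in $s[\vec{x} := t]$ the $x_i$ are bound in $s$; terms up to renaming of bound variables. Typing rules: $x:a \vdash x:a$; if $\gamma_i \vdash s_i : a_i$ then $\gamma_1,\dots,\gamma_k \vdash \langle s_1,\dots,s_k\rangle : (a_1\otimes\cdots\otimes a_k)$; if $\gamma \vdash t : (a_1 \otimes\cdots\otimes a_k)$ and $\delta, x_1:a_1,\dots,x_k:a_k, \delta' \vdash s : b$ then $\delta,\gamma,\delta' \vdash s[x_1^{a_1},\dots,x_k^{a_k} := t] : b$; combined contexts are disjoint lists of distinct variables. $\mathrm{Rep}(\mathcal{R})(a_1,\dots,a_n;a)$ = terms $s$ with $x_1:a_1,\dots,x_n:a_n \vdash s : a$ (contexts up to renaming of variables). Contexts with one hole: $\mathtt{C} ::= [\cdot] \mid \langle s_1,\dots,\mathtt{C},\dots,s_k\rangle \mid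 \mathtt{C}[\vec{x}:=t] \mid s[\vec{x} := \mathtt{C}]$; $\mathtt{E}$ same grammar except that $s[\vec{x} := \mathtt{E}]$ requires $\mathtt{E} \neq [\cdot]$; $\mathtt{L} ::= [\cdot] \mid \mathtt{L}[\vec{x} := t]$; $\mathsf{LT}$ = terms $\mathtt{L}[\langle s_1,\dots,s_k\rangle]$. $\beta$: $s[x_1,\dots,x_k := \mathtt{L}[\langle t_1,\dots,t_k\rangle]] \to_\beta \mathtt{L}[s\{t_1/x_1,\dots,t_k/x_k\}]$ (capture-avoiding substitution), closed under $\mathtt{C}$-contexts; $\eta$: $s \to_\eta \langle x_1,\dots,x_k\rangle[x_1^{a_1},\dots,x_k^{a_k} := s]$ when $s$ has type $(a_1\otimes\cdots\otimes a_k)$, $x_i$ fresh, $s\notin\mathsf{LT}$, closed under $\mathtt{E}$-contexts; $\to_{\mathsf{rep}} = \to_\beta\cup\to_\eta$. Structural equivalence $\equiv$: smallest congruence containing $\mathtt{C}[s[\vec{x}:=t]] \equiv \mathtt{C}[s][\vec{x}:=t]$ whenever $\mathtt{C}$ binds no free variable of $t$ and $\vec{x}$ do not occur free in $\mathtt{C}$. *)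

(* Defs.v *)
From Stdlib Require List.
From mathcomp Require Import all_boot.

Set Implicit Arguments.
Unset Strict Implicit.
Unset Printing Implicit Defensive.

Inductive ty (A : Type) : Type :=
| Atom (o : A)
| Tensor (bs : seq (ty A)).

Arguments Atom {A} o.
Arguments Tensor {A} bs.

Record rep_signature : Type := RepSignature {
  atom : Type;
  multiarrow : seq (ty atom) -> ty atom -> Type
}.

Definition discrete (R : rep_signature) : Prop :=
  forall (bs : seq (ty (atom R))) (b : ty (atom R)), multiarrow bs b -> False.

(* Terms of a discrete signature, up to renaming of bound variables: free      *)
(* variables are natural numbers and binders are de Bruijn.                    *)
(* [Let s [:: a_1; ..; a_k] t] is s[x_1^a_1, .., x_k^a_k := t]: inside s, the  *)
(* index i < k stands for x_(i+1) and k + j for the variable j of the outside. *)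
Inductive term (A : Type) : Type :=
| Var (i : nat)
| Tup (ss : seq (term A))
| Let (s : term A) (bs : seq (ty A)) (t : term A).

Arguments Var {A} i.
Arguments Tup {A} ss.
Arguments Let {A} s bs t.

Definition upren (k : nat) (f : nat -> nat) (i : nat) : nat :=
  if i < k then i else k + f (i - k).

Fixpoint ren {A : Type} (f : nat -> nat) (t : term A) : term A :=
  match t with
  | Var i => Var (f i)
  | Tup ss => Tup (map (ren f) ss)
  | Let s bs u => Let (ren (upren (size bs) f) s) bs (ren f u)
  end.

Definition upsubst {A : Type} (k : nat) (f : nat -> term A) (i : nat) : term A :=
  if i < k then Var i else ren (addn k) (f (i - k)).

Fixpoint subst {A : Type} (f : nat -> term A) (t : term A) : term A :=
  match t with
  | Var i => f i
  | Tup ss => Tup (map (subst f) ss)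
  | Let s bs u => Let (subst (upsubst (size bs) f) s) bs (subst f u)
  end.

Definition ctx (A : Type) : Type := seq (nat * ty A).

Definition vars {A : Type} (G : ctx A) : seq nat := unzip1 G.

Definition lift_ctx {A : Type} (k : nat) (G : ctx A) : ctx A :=
  [seq (k + p.1, p.2) | p <- G].

(* x_1 : a_1, .., x_k : a_k for the variables bound by a [Let] *)
Definition bind_ctx {A : Type} (bs : seq (ty A)) : ctx A :=
  zip (iota 0 (size bs)) bs.

(* Contexts are ordered, so there is no exchange. [typings G ss bs] says that  *)
(* G = G_1, .., G_k with G_i |- s_i : a_i for each i.                          *)
Inductive typing {A : Type} : ctx A -> term A -> ty A -> Prop :=
| T_Var (i : nat) (b : ty A) : typing [:: (i, b)] (Var i) b
| T_Tup (G : ctx A) (ss : seq (term A)) (bs : seq (ty A)) :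
    typings G ss bs -> typing G (Tup ss) (Tensor bs)
| T_Let (D G D' : ctx A) (s t : term A) (bs : seq (ty A)) (b : ty A) :
    uniq (vars (D ++ G ++ D')) ->
    typing G t (Tensor bs) ->
    typing (lift_ctx (size bs) D ++ bind_ctx bs ++ lift_ctx (size bs) D') s b ->
    typing (D ++ G ++ D') (Let s bs t) b
with typings {A : Type} : ctx A -> seq (term A) -> seq (ty A) -> Prop :=
| T_nil : typings [::] [::] [::]
| T_cons (G G' : ctx A) (s : term A) (ss : seq (term A))
    (b : ty A) (bs : seq (ty A)) :
    uniq (vars (G ++ G')) ->
    typing G s b -> typings G' ss bs -> typings (G ++ G') (s :: ss) (b :: bs).

Definition Rep (R : rep_signature) (G : ctx (atom R)) (b : ty (atom R))
    (s : term (atom R)) : Prop :=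
  typing G s b.

Inductive hctx (A : Type) : Type :=
| Hole
| CTup (ss : seq (term A)) (C : hctx A) (ss' : seq (term A))
| CLetBody (C : hctx A) (bs : seq (ty A)) (t : term A)
| CLetArg (s : term A) (bs : seq (ty A)) (C : hctx A).

Arguments Hole {A}.
Arguments CTup {A} ss C ss'.
Arguments CLetBody {A} C bs t.
Arguments CLetArg {A} s bs C.

Fixpoint plug {A : Type} (C : hctx A) (u : term A) : term A :=
  match C with
  | Hole => u
  | CTup ss C' ss' => Tup (ss ++ plug C' u :: ss')
  | CLetBody C' bs t => Let (plug C' u) bs t
  | CLetArg s bs C' => Let s bs (plug C' u)
  end.

(* number of variables bound by C at its hole *)
Fixpoint depth {A : Type} (C : hctx A) : nat :=
  match C with
  | Hole => 0
  | CTup _ C' _ => depth C'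
  | CLetBody C' bs _ => depth C' + size bs
  | CLetArg _ _ C' => depth C'
  end.

Fixpoint ren_hctx {A : Type} (f : nat -> nat) (C : hctx A) : hctx A :=
  match C with
  | Hole => Hole
  | CTup ss C' ss' => CTup (map (ren f) ss) (ren_hctx f C') (map (ren f) ss')
  | CLetBody C' bs t => CLetBody (ren_hctx (upren (size bs) f) C') bs (ren f t)
  | CLetArg s bs C' => CLetArg (ren (upren (size bs) f) s) bs (ren_hctx f C')
  end.

(* the typed variables in scope at the hole of C when those of G are in scope  *)
(* at its root                                                                 *)
Fixpoint hole_scope {A : Type} (C : hctx A) (G : ctx A) : ctx A :=
  match C with
  | Hole => G
  | CTup _ C' _ => hole_scope C' G
  | CLetBody C' bs _ => hole_scope C' (bind_ctx bs ++ lift_ctx (size bs) G)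
  | CLetArg _ _ C' => hole_scope C' G
  end.

Definition is_hole {A : Type} (C : hctx A) : bool :=
  if C is Hole then true else false.

Fixpoint Ectx {A : Type} (C : hctx A) : bool :=
  match C with
  | Hole => true
  | CTup _ C' _ => Ectx C'
  | CLetBody C' _ _ => Ectx C'
  | CLetArg _ _ C' => ~~ is_hole C' && Ectx C'
  end.

Fixpoint Lctx {A : Type} (C : hctx A) : bool :=
  match C with
  | Hole => true
  | CLetBody C' _ _ => Lctx C'
  | _ => false
  end.

Definition LT {A : Type} (t : term A) : Prop :=
  exists (L : hctx A) (ss : seq (term A)), Lctx L /\ t = plug L (Tup ss).

(* The substitution {t_1/x_1, .., t_k/x_k} performed at the hole of a context  *)
(* of depth d: the variables other than the x_i must skip its d binders.       *)
Definition beta_subst {A : Type} (d : nat) (ts : seq (term A)) (i : nat) : term A :=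
  nth (Var (d + (i - size ts))) ts i.

Inductive beta_root {A : Type} : term A -> term A -> Prop :=
| Beta_root (L : hctx A) (s : term A) (bs : seq (ty A)) (ts : seq (term A)) :
    Lctx L -> size bs = size ts ->
    beta_root (Let s bs (plug L (Tup ts)))
              (plug L (subst (beta_subst (depth L) ts) s)).

Inductive beta {A : Type} : term A -> term A -> Prop :=
| Beta (C : hctx A) (s t : term A) :
    beta_root s t -> beta (plug C s) (plug C t).

Definition eta_expand {A : Type} (bs : seq (ty A)) (s : term A) : term A :=
  Let (Tup [seq Var i | i <- iota 0 (size bs)]) bs s.

(* The condition that s has a tensor type refers to the types of the variables *)
(* in scope at s, hence the context G of the whole term.                       *)
Inductive eta {A : Type} (G : ctx A) : term A -> term A -> Prop :=
| Eta (E : hctx A) (D : ctx A) (s : term A) (bs : seq (ty A)) :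
    Ectx E ->
    List.incl D (hole_scope E G) -> typing D s (Tensor bs) ->
    ~ LT s ->
    eta G (plug E s) (plug E (eta_expand bs s)).

Definition rep_step {A : Type} (G : ctx A) (s t : term A) : Prop :=
  beta s t \/ eta G s t.

Definition rep_normal {A : Type} (G : ctx A) (s : term A) : Prop :=
  forall t : term A, ~ rep_step G s t.

(* Exchanges the two innermost blocks of binders, of sizes k and then d. *)
Definition swap_binders (k d i : nat) : nat :=
  if i < k then d + i else if i < k + d then i - k else i.

(* In [SE_let], t lives outside C, so that C binds none of its variables once  *)
(* it is lifted under the binders of C; and C is a context outside the scope   *)
(* of the x_i, so that they do not occur in it.                                *)
Inductive struct_eq {A : Type} : term A -> term A -> Prop :=
| SE_refl (s : term A) : struct_eq s s
| SE_sym (s t : term A) : struct_eq s t -> struct_eq t s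
| SE_trans (s t u : term A) : struct_eq s t -> struct_eq t u -> struct_eq s u
| SE_ctx (C : hctx A) (s t : term A) :
    struct_eq s t -> struct_eq (plug C s) (plug C t)
| SE_let (C : hctx A) (s t : term A) (bs : seq (ty A)) :
    struct_eq
      (plug C (Let s bs (ren (addn (depth C)) t)))
      (Let (plug (ren_hctx (addn (size bs)) C)
                 (ren (swap_binders (size bs) (depth C)) s))
           bs t).

(* Main.v *)
From Stdlib Require List.
Require Import Defs.
From mathcomp Require Import all_boot.

Set Implicit Arguments.
Unset Strict Implicit.
Unset Printing Implicit Defensive.

(** In a normal term every [Let] destructs a variable: a tuple under [Let] (even
    below further [Let]s) is a beta-redex, and a variable of tensor type anywhere
    else is an eta-redex. By linearity each tensor-typed variable of the context
    is therefore destructed by exactly one [Let], and structural equivalence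
    moves that [Let] to the root. Doing this to both terms for the same variable
    and recursing on the number of tensors in the context reduces the theorem to
    contexts of atoms. There no [Let] is left and, as contexts are ordered, the
    type alone determines how the context is split among the components of
    tuples, so the two terms coincide. *)

(* The normal-form judgement *)
Scheme typing_mind := Minimality for typing Sort Prop
  with typings_mind := Minimality for typings Sort Prop.

(** Carries no disjointness condition on contexts, which makes it stable under arbitrary, even
    non-injective, renamings. *)
Inductive nf {A : Type} : ctx A -> term A -> ty A -> Prop :=
| NF_Var (i : nat) (o : A) : nf [:: (i, Atom o)] (Var i) (Atom o)
| NF_Tup (G : ctx A) (ss : seq (term A)) (bs : seq (ty A)) :
    nfs G ss bs -> nf G (Tup ss) (Tensor bs)
| NF_Let (D D' : ctx A) (i : nat) (s : term A) (bs : seq (ty A)) (b : ty A) :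
    nf (lift_ctx (size bs) D ++ bind_ctx bs ++ lift_ctx (size bs) D') s b ->
    nf (D ++ (i, Tensor bs) :: D') (Let s bs (Var i)) b
with nfs {A : Type} : ctx A -> seq (term A) -> seq (ty A) -> Prop :=
| NF_nil : nfs [::] [::] [::]
| NF_cons (G G' : ctx A) (s : term A) (ss : seq (term A))
    (b : ty A) (bs : seq (ty A)) :
    nf G s b -> nfs G' ss bs -> nfs (G ++ G') (s :: ss) (b :: bs).

Scheme nf_mind := Minimality for nf Sort Prop
  with nfs_mind := Minimality for nfs Sort Prop.
Combined Scheme nf_nfs_ind from nf_mind, nfs_mind.

Lemma cat_eq_cat_cons (T : Type) (G1 G2 D D' : seq T) (x : T) :
  G1 ++ G2 = D ++ x :: D' ->
  (exists2 M, G1 = D ++ x :: M & D' = M ++ G2) \/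
  (exists2 M, D = G1 ++ M & G2 = M ++ x :: D').
Proof.
elim: G1 D => [|y G1 IH] [|z D] //=.
- by move=> ->; right; exists [::].
- by move=> ->; right; exists (z :: D).
- by case=> -> <-; left; exists G1.
case=> -> /IH [[M -> ->]|[M -> ->]]; first by left; exists M.
by right; exists M.
Qed.

(** * Renaming of contexts and of normal forms *)

Section Renaming.

Variable A : Type.
Implicit Types (G D : ctx A) (s t : term A) (bs cs : seq (ty A)).
Implicit Types (f g : nat -> nat).

Definition ren_ctx f G : ctx A := [seq (f p.1, p.2) | p <- G].

Lemma lift_ctxE k G : lift_ctx k G = ren_ctx (addn k) G.
Proof. by []. Qed.

Lemma ren_ctx_cat f G D : ren_ctx f (G ++ D) = ren_ctx f G ++ ren_ctx f D.
Proof. exact: map_cat. Qed.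

Lemma eq_ren_ctx f g G : f =1 g -> ren_ctx f G = ren_ctx g G.
Proof. by move=> fg; apply: eq_map => p; rewrite fg. Qed.

Lemma ren_ctx_comp f g G : ren_ctx f (ren_ctx g G) = ren_ctx (f \o g) G.
Proof. by rewrite /ren_ctx -map_comp. Qed.

Lemma ren_ctx_id G : ren_ctx id G = G.
Proof. by rewrite -[RHS]map_id; apply: eq_map => -[]. Qed.

Lemma eq_ren_bind_ctx f g bs :
  (forall i, i < size bs -> f i = g i) ->
  ren_ctx f (bind_ctx bs) = ren_ctx g (bind_ctx bs).
Proof.
move=> fg.
(* The index list is generalised because the tail of [iota 0 _] no longer starts at 0. *)
have ren_zip h xs : ren_ctx h (zip xs bs) = zip (map h xs) bs.
  by rewrite /ren_ctx; elim: xs {fg} bs => [|x xs IH] [|b bs] //=; rewrite IH.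
rewrite /bind_ctx !ren_zip; congr zip; apply/eq_in_map => i.
by rewrite mem_iota => /fg.
Qed.

Lemma ren_bind_ctx_id f bs :
  (forall i, i < size bs -> f i = i) -> ren_ctx f (bind_ctx bs) = bind_ctx bs.
Proof. by move=> fi; rewrite (eq_ren_bind_ctx (g := id)) // ren_ctx_id. Qed.

Lemma ren_upren_lift_ctx k f G :
  ren_ctx (upren k f) (lift_ctx k G) = lift_ctx k (ren_ctx f G).
Proof.
rewrite !lift_ctxE !ren_ctx_comp; apply: eq_ren_ctx => i /=.
by rewrite /upren ltnNge leq_addr /= addKn.
Qed.

Lemma ren_upren_bind_ctx f bs :
  ren_ctx (upren (size bs) f) (bind_ctx bs) = bind_ctx bs.
Proof. by apply: ren_bind_ctx_id => i lt_i; rewrite /upren lt_i. Qed.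

(** This and the next two lemmas describe the effect on contexts of exchanging two blocks of
    binders, as happens when one [Let] moves across another. *)
Lemma ren_swap_bind_ctx m bs :
  ren_ctx (swap_binders (size bs) m) (bind_ctx bs) = lift_ctx m (bind_ctx bs).
Proof. by apply: eq_ren_bind_ctx => i lt_i; rewrite /swap_binders lt_i. Qed.

Lemma ren_swap_lift_bind_ctx k cs :
  ren_ctx (swap_binders k (size cs)) (lift_ctx k (bind_ctx cs)) = bind_ctx cs.
Proof.
rewrite ren_ctx_comp; apply: ren_bind_ctx_id => i lt_i /=.
by rewrite /swap_binders ltnNge leq_addr ltn_add2l lt_i addKn.
Qed.

Lemma ren_swap_lift_lift_ctx k m G :
  ren_ctx (swap_binders k m) (lift_ctx k (lift_ctx m G)) =
  lift_ctx m (lift_ctx k G).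
Proof.
rewrite !lift_ctxE !ren_ctx_comp; apply: eq_ren_ctx => i /=.
by rewrite /swap_binders ltnNge leq_addr ltn_add2l ltnNge leq_addr /= addnCA.
Qed.

(** A tuple frame binds nothing, so [SE_let] across it renames with [swap_binders k 0]. *)
Lemma ren_swap0_ctx k G : ren_ctx (swap_binders k 0) G = G.
Proof.
rewrite -[RHS]ren_ctx_id; apply: eq_ren_ctx => i.
by rewrite /swap_binders addn0; case: ifP => // ->.
Qed.

Lemma nf_nfs_ren :
  (forall G s b, nf G s b -> forall f, nf (ren_ctx f G) (ren f s) b) /\
  (forall G ss bs, nfs G ss bs ->
     forall f, nfs (ren_ctx f G) (map (ren f) ss) bs).
Proof.
apply: nf_nfs_ind => /=.
- by move=> i o f; apply: NF_Var.
- by move=> G ss bs _ IH f; apply: NF_Tup.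
- move=> D D' i s bs b _ IH f; rewrite ren_ctx_cat; apply: NF_Let.
  by have := IH (upren (size bs) f);
    rewrite !ren_ctx_cat !ren_upren_lift_ctx ren_upren_bind_ctx.
- by move=> f; apply: NF_nil.
- by move=> G G' s ss b bs _ IH _ IHs f; rewrite ren_ctx_cat; apply: NF_cons.
Qed.

Lemma nf_ren f G s b : nf G s b -> nf (ren_ctx f G) (ren f s) b.
Proof. by move=> nfs; apply: (proj1 nf_nfs_ren). Qed.

Lemma nfs_ren f G ss bs :
  nfs G ss bs -> nfs (ren_ctx f G) (map (ren f) ss) bs.
Proof. by move=> nfss; apply: (proj2 nf_nfs_ren). Qed.

End Renaming.

(** * From typed normal terms to [nf], and their structural equivalence *)

Section NormalForms.

Variable A : Type.
Implicit Types (G D : ctx A) (s t : term A) (bs cs : seq (ty A)).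

(** Descending through the bodies of [Let]s ends at a variable or a tuple, and variables of an [nf]
    have atomic type. *)
Lemma nf_tensorP G s bs :
  nf G s (Tensor bs) ->
  exists L ts, [/\ Lctx L, s = plug L (Tup ts) & size bs = size ts].
Proof.
suff [/(_ G s (Tensor bs)) nfP _] :
  (forall G s b, nf G s b -> forall bs, b = Tensor bs ->
    exists L ts, [/\ Lctx L, s = plug L (Tup ts) & size bs = size ts]) /\
  (forall G ss bs, nfs G ss bs -> size bs = size ss).
  by move=> /nfP; apply.
apply: nf_nfs_ind => //.
- by move=> {}G ss cs _ sz _ [<-]; exists Hole, ss.
- move=> D D' i {}s cs b _ IH ds /IH [L [ts [LL -> sz]]].
  by exists (CLetBody L cs (Var i)), ts.
- by move=> {}G G' {}s ss b cs _ _ _ /= ->.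
Qed.

Lemma not_LT_Var i : ~ LT (Var i : term A).
Proof. by case=> -[|? ? ?|? ? ?|? ? ?] [ts []]. Qed.

Lemma rep_normal_Tup G l s r :
  rep_normal G (Tup (l ++ s :: r)) -> rep_normal G s.
Proof.
move=> norm t [st|st].
- case: st norm => C u v uv /(_ (Tup (l ++ plug C v :: r))); apply.
  by left; apply: (Beta (CTup l C r)).
- case: st norm => E D u bs EE sub ty_u nlt.
  move=> /(_ (Tup (l ++ plug E (eta_expand bs u) :: r))); apply.
  by right; apply: (Eta (E := CTup l E r) EE sub ty_u).
Qed.

Lemma rep_normal_Let_body G s bs t :
  rep_normal G (Let s bs t) ->
  rep_normal (bind_ctx bs ++ lift_ctx (size bs) G) s.
Proof.
move=> norm s' [st|st].
- case: st norm => C u v uv /(_ (Let (plug C v) bs t)); apply.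
  by left; apply: (Beta (CLetBody C bs t)).
- case: st norm => E D u cs EE sub ty_u nlt.
  move=> /(_ (Let (plug E (eta_expand cs u)) bs t)); apply.
  by right; apply: (Eta (E := CLetBody E bs t) EE sub ty_u).
Qed.

(** Eta is barred at the argument of a [Let], so the argument itself may fail to be normal; its body
    is one frame deeper, where the surrounding context is again an [Ectx]. *)
Lemma rep_normal_Let_arg_body G s bs s0 cs t :
  rep_normal G (Let s bs (Let s0 cs t)) ->
  rep_normal (bind_ctx cs ++ lift_ctx (size cs) G) s0.
Proof.
move=> norm s' [st|st].
- case: st norm => C u v uv /(_ (Let s bs (Let (plug C v) cs t))); apply.
  by left; apply: (Beta (CLetArg s bs (CLetBody C cs t))).
- case: st norm => E D u ds EE sub ty_u nlt.
  move=> /(_ (Let s bs (Let (plug E (eta_expand ds u)) cs t))); apply.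
  by right; apply: (Eta (E := CLetArg s bs (CLetBody E cs t)) EE sub ty_u).
Qed.

Lemma rep_normal_not_beta_root G s t : rep_normal G s -> ~ beta_root s t.
Proof. by move=> norm st; apply: (norm t); left; apply: (Beta Hole). Qed.

Lemma In_cat (T : Type) (x : T) (l r : seq T) :
  List.In x (l ++ r) <-> List.In x l \/ List.In x r.
Proof. exact: List.in_app_iff. Qed.

Lemma incl_lift_ctx k G D :
  List.incl G D -> List.incl (lift_ctx k G) (lift_ctx k D).
Proof. exact: List.incl_map. Qed.

Lemma incl_Let_body D G D' G0 bs :
  List.incl (D ++ G ++ D') G0 ->
  List.incl (lift_ctx (size bs) D ++ bind_ctx bs ++ lift_ctx (size bs) D')
    (bind_ctx bs ++ lift_ctx (size bs) G0).
Proof.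
move=> sub x; rewrite !In_cat => -[xD|[xb|xD']]; [right| by left |right].
- by apply: incl_lift_ctx xD => y yD; apply: sub; rewrite !In_cat; left.
- by apply: incl_lift_ctx xD' => y yD; apply: sub; rewrite !In_cat; right; right.
Qed.

Lemma typing_rep_normal_nf G s a : typing G s a -> rep_normal G s -> nf G s a.
Proof.
move=> ty_s.
(* The second clause treats [s] as the argument of a [Let], where eta is barred but beta may fire.
   [G0] is the whole scope, which can exceed the linear context [G]. *)
pose P G s a :=
  (forall G0, List.incl G G0 -> rep_normal G0 s -> nf G s a) /\
  (forall G0 u bs, List.incl G G0 -> a = Tensor bs ->
     rep_normal G0 (Let u bs s) -> exists i, s = Var i).
(* [l] holds the components already passed; the size equation is a premise of [Beta_root]. *)
pose Ps (G : ctx A) ss bs :=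
  (forall G0 l, List.incl G G0 -> rep_normal G0 (Tup (l ++ ss)) -> nfs G ss bs) /\
  size bs = size ss.
suff [nfP _] : P G s a by apply: nfP; apply: List.incl_refl.
apply: (typing_mind (P := P) (P0 := Ps)) ty_s; rewrite {}/P {}/Ps => {G s a} /=.
- move=> i b; split=> [G0 sub norm|*]; last by exists i.
  case: b norm sub => [o _ _|bs norm sub]; first exact: NF_Var.
  case: (norm (eta_expand bs (Var i))); right.
  by apply: (Eta (E := Hole) _ sub (T_Var i _)) => //; apply: not_LT_Var.
- move=> G ss bs _ [IHss sz]; split=> [G0 sub norm|G0 u cs sub [<-] norm].
    exact/NF_Tup/(IHss G0 [::]).
  by have /(rep_normal_not_beta_root norm) := Beta_root (L := Hole) u erefl sz.
- move=> D G D' s t bs b _ ty_t [_ IHt] _ [IHs _].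
  split=> [G0 sub norm|G0 u cs sub eq_b norm].
    have [|i eq_t] := IHt G0 s bs _ erefl norm.
      by move=> x xG; apply: sub; rewrite !In_cat; right; left.
    have {}IHs := IHs _ (incl_Let_body sub) (rep_normal_Let_body norm).
    (* Inversion reduces the context of the argument to the single entry of its variable. *)
    by rewrite eq_t in ty_t *; inversion ty_t; subst; apply: NF_Let.
  (* A [Let] in argument position is contradictory: by [nf_tensorP] its body is a tuple below
     [Let]s, giving a beta-redex. *)
  have /= := IHs _ (incl_Let_body sub) (rep_normal_Let_arg_body norm).
  rewrite eq_b => /nf_tensorP [L [ts [LL eq_s sz]]].
  rewrite eq_s in norm.
  by have /(rep_normal_not_beta_root norm) :=
    Beta_root (L := CLetBody L bs t) u LL sz.
- by split=> // *; apply: NF_nil.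
- move=> G G' s ss b bs _ _ [IHs _] _ [IHss sz]; split=> [G0 l sub norm|/=].
  2: by rewrite sz.
  apply: NF_cons.
    apply: IHs (rep_normal_Tup norm) => x xG.
    by apply: sub; rewrite In_cat; left.
  apply: (IHss G0 (rcons l s)) => [x xG|]; last by rewrite cat_rcons.
  by apply: sub; rewrite In_cat; right.
Qed.

(** The chosen entry belongs to one premise of the last rule; the induction hypothesis brings its
    [Let] to the root there, and [SE_let] moves it past the last constructor. A list of components
    has no root, so the second half only records the position and leaves that move to the tuple
    case. *)
Lemma nf_nfs_pull :
  (forall G s b, nf G s b ->
     forall D i cs D', G = D ++ (i, Tensor cs) :: D' ->
     exists2 s1,
       nf (lift_ctx (size cs) D ++ bind_ctx cs ++ lift_ctx (size cs) D') s1 b &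
       struct_eq s (Let s1 cs (Var i))) /\
  (forall G ss bs, nfs G ss bs ->
     forall D i cs D', G = D ++ (i, Tensor cs) :: D' ->
     exists l s r s1,
       [/\ ss = l ++ s :: r, struct_eq s (Let s1 cs (Var i)) &
        nfs (lift_ctx (size cs) D ++ bind_ctx cs ++ lift_ctx (size cs) D')
          (map (ren (addn (size cs))) l ++
           ren (swap_binders (size cs) 0) s1 :: map (ren (addn (size cs))) r)
          bs]).
Proof.
apply: nf_nfs_ind.
- by move=> i o [|? [|? ?]].
- move=> G ss bs _ IH D i cs D' /IH [l [s [r [s1 [-> s_s1 nf_s1]]]]].
  exists (Tup (map (ren (addn (size cs))) l ++
           ren (swap_binders (size cs) 0) s1 :: map (ren (addn (size cs))) r)).
    exact: NF_Tup.
  apply: SE_trans (SE_ctx (CTup l Hole r) s_s1) _.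
  exact: (SE_let (CTup l Hole r) s1 (Var i) cs).
- move=> D0 D0' j s bs b nf_s IH D i cs D' eqD.
  pose sw := swap_binders (size cs) (size bs).
  have pull s1 : struct_eq s (Let s1 cs (Var (size bs + i))) ->
      struct_eq (Let s bs (Var j))
        (Let (Let (ren sw s1) bs (Var (size cs + j))) cs (Var i)).
    move=> s_s1; apply: SE_trans (SE_ctx (CLetBody Hole bs (Var j)) s_s1) _.
    exact: (SE_let (CLetBody Hole bs (Var j)) s1 (Var i) cs).
  have renE := (ren_ctx_cat, ren_swap_lift_lift_ctx, ren_swap_bind_ctx,
    ren_swap_lift_bind_ctx).
  (* The chosen entry stands before the one destructed at the root, is that entry, or stands after
     it; in the middle case the root [Let] is already the wanted one. *)
  case: (cat_eq_cat_cons eqD) => [[M eqD0 ->]|[[|x M] -> [eq_j eq_bs]]].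
  + have [|s1 /(nf_ren sw) nf_s1 /pull s_s1] := IH (lift_ctx (size bs) D)
      (size bs + i) cs (lift_ctx (size bs) M ++ bind_ctx bs ++ lift_ctx (size bs) D0').
      by rewrite eqD0 lift_ctxE ren_ctx_cat -catA.
    exists (Let (ren sw s1) bs (Var (size cs + j))) => //.
    rewrite [X in _ ++ _ ++ X]ren_ctx_cat !catA; apply: NF_Let.
    by move: nf_s1; rewrite !lift_ctxE !ren_ctx_cat -!lift_ctxE !renE -!catA.
  + by rewrite cats0 -eq_j -eq_bs => <-; exists s => //; apply: SE_refl.
  + have [|s1 /(nf_ren sw) nf_s1 /pull s_s1] := IH (lift_ctx (size bs) D0 ++
      bind_ctx bs ++ lift_ctx (size bs) M) (size bs + i) cs (lift_ctx (size bs) D').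
      by rewrite eq_bs !lift_ctxE !ren_ctx_cat -!catA.
    exists (Let (ren sw s1) bs (Var (size cs + j))) => //.
    rewrite [lift_ctx _ _]ren_ctx_cat -catA -eq_j /=; apply: NF_Let.
    by move: nf_s1; rewrite !lift_ctxE !ren_ctx_cat -!lift_ctxE !renE -!catA.
- by move=> [|? ?].
- move=> G G' s ss b bs nf_s IHs nf_ss IHss D i cs D' eqD.
  case: (cat_eq_cat_cons eqD) => [[M eqG ->]|[M -> eqG']].
  + have [s1 nf_s1 s_s1] := IHs _ _ _ _ eqG.
    exists [::], s, ss, s1; split=> //=.
    rewrite [X in _ ++ _ ++ X]ren_ctx_cat !catA; apply: NF_cons (nfs_ren _ nf_ss).
    by move/(nf_ren (swap_binders (size cs) 0)): nf_s1; rewrite ren_swap0_ctx catA.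
  + have [l [t [r [t1 [-> t_t1 nf_t1]]]]] := IHss _ _ _ _ eqG'.
    exists (s :: l), t, r, t1; split=> //=.
    by rewrite [lift_ctx _ _]ren_ctx_cat -catA; apply: NF_cons => //; apply: nf_ren.
Qed.

(** * The induction measure and contexts of atoms *)

Fixpoint tensors (a : ty A) : nat :=
  if a is Tensor bs then (sumn (map tensors bs)).+1 else 0.

(** Replacing a tensor entry by its components lowers this by exactly one, even for the empty
    tensor. *)
Definition ctx_tensors G : nat := sumn [seq tensors p.2 | p <- G].

Lemma ctx_tensors_cat G D :
  ctx_tensors (G ++ D) = ctx_tensors G + ctx_tensors D.
Proof. by rewrite /ctx_tensors map_cat sumn_cat. Qed.

Lemma ctx_tensors_ren f G : ctx_tensors (ren_ctx f G) = ctx_tensors G.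
Proof. by rewrite /ctx_tensors -map_comp. Qed.

Lemma ctx_tensors_bind bs : ctx_tensors (bind_ctx bs) = sumn (map tensors bs).
Proof.
rewrite /ctx_tensors /bind_ctx (map_comp tensors snd) -/unzip2 unzip2_zip //.
by rewrite size_iota.
Qed.

Lemma ctx_tensors_gt0 G :
  0 < ctx_tensors G -> exists D i cs D', G = D ++ (i, Tensor cs) :: D'.
Proof.
elim: G => [|[i [o|cs]] G IH] //=; last by exists [::], i, cs, G.
by case/IH=> D [j [cs [D' ->]]]; exists ((i, Atom o) :: D), j, cs, D'.
Qed.

(* The trailing contexts [H] and [H'] keep the induction from depending on how
   the context is split among the components of a tuple. *)
Lemma nf_nfs_atomic_inj :
  (forall G s b, nf G s b -> forall G' s' H H', nf G' s' b ->
     ctx_tensors G = 0 -> ctx_tensors G' = 0 -> G ++ H = G' ++ H' ->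
     G = G' /\ s = s') /\
  (forall G ss bs, nfs G ss bs -> forall G' ss' H H', nfs G' ss' bs ->
     ctx_tensors G = 0 -> ctx_tensors G' = 0 -> G ++ H = G' ++ H' ->
     G = G' /\ ss = ss').
Proof.
have no_let D i cs D' : ctx_tensors (D ++ (i, Tensor cs) :: D') <> 0.
  by rewrite ctx_tensors_cat addnS.
apply: nf_nfs_ind.
- move=> i o G' s' H H' nf' _ G'0; inversion nf'; subst.
    by case=> ->.
  by case: (no_let _ _ _ _ G'0).
- move=> G ss bs _ IH G' s' H H' nf' G0 G'0 eqG; inversion nf'; subst.
    by have [||||-> ->] := IH G' ss0 H H'.
  by case: (no_let _ _ _ _ G'0).
- by move=> D D' i s bs b _ _ G' s' H H' _ /no_let.
- by move=> G' ss' H H' nf'; inversion nf'.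
- move=> G1 G2 s ss b bs _ IHs _ IHss G' ss' H H' nf'; inversion nf'; subst.
  rewrite !ctx_tensors_cat -!catA.
  move=> /eqP; rewrite addn_eq0 => /andP [/eqP ? /eqP ?].
  move=> /eqP; rewrite addn_eq0 => /andP [/eqP ? /eqP ?] eqG.
  (* The context of the later components serves as trailing context here; once the split points
     agree, the common head is dropped. *)
  have [//|//|//|? ?] := IHs _ s0 _ _ _ _ _ eqG; subst.
  move/(f_equal (drop (size G))): eqG; rewrite !drop_size_cat // => eqG.
  by have [//|//|//|? ?] := IHss _ ss0 _ _ _ _ _ eqG; subst.
Qed.

Lemma nf_struct_eq G a s s' : nf G s a -> nf G s' a -> struct_eq s s'.
Proof.
elim: {G}(ctx_tensors G) {-2}G (leqnn (ctx_tensors G)) s s' => [|n IH] G.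
  rewrite leqn0 => /eqP G0 s s' nf_s nf_s'.
  have [_ ->] := proj1 nf_nfs_atomic_inj _ _ _ nf_s G s' [::] [::] nf_s' G0 G0 erefl.
  exact: SE_refl.
move=> le_n s s' nf_s nf_s'; case: (posnP (ctx_tensors G)) => [G0|].
  by apply: IH nf_s nf_s'; rewrite G0.
case/ctx_tensors_gt0=> D [i [cs [D' eqG]]].
(* Pulling the same entry in both terms gives two bodies with the same context and type. *)
have [s1 nf_s1 s_s1] := proj1 nf_nfs_pull _ _ _ nf_s _ _ _ _ eqG.
have [s1' nf_s1' s_s1'] := proj1 nf_nfs_pull _ _ _ nf_s' _ _ _ _ eqG.
apply: SE_trans s_s1 (SE_trans _ (SE_sym s_s1')).
apply: (SE_ctx (CLetBody Hole cs (Var i))); apply: IH nf_s1 nf_s1'.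
move: le_n; rewrite eqG !ctx_tensors_cat !ctx_tensors_ren ctx_tensors_bind.
by rewrite /ctx_tensors /= -/(ctx_tensors _) addSn addnS.
Qed.

End NormalForms.

Theorem theorem3p17 (R : rep_signature) (HR : discrete R)
    (G : ctx (atom R)) (a : ty (atom R)) (s s' : term (atom R)) :
  Rep G a s -> Rep G a s' ->
  rep_normal G s -> rep_normal G s' ->
  struct_eq s s'.
Proof.
move=> ty_s ty_s' norm norm'.
by apply: (nf_struct_eq (G := G) (a := a)); apply: typing_rep_normal_nf.
Qed.
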